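(* For each $$r \in \{13, 17, 20, 21, 24, 25, 40, 45, 60, 65, 80, 85, 100, 105, 120, 125, 140, 145, 160, 165, 180, 185\},$$ there exists a pentagonal geometry $\mathrm{PENT}(4,r)$ with a connected deficiency graph of girth at least $5$ and a best possible identifying code. Additionally, when $r = 13$ and when $r \equiv 0 \pmod 5$, the identifying code $S$ of the $\mathrm{PENT}(4,r)$ has $\pi_0(S) = 0$.
   Context: A partial linear space is a (finite) set of points together with a set of lines, each line identified with the set of points incident with it, such that two distinct points lie on at most one common line. Two points are collinear if some line contains both (so a point that lies on a line is collinear with itself). A pentagonal geometry $\mathrm{PENT}(k,r)$ is a partial linear space in which every line has exactly $k$ points, every point is on exactly $r$ lines, and for every point $x$ the set of points not collinear with $x$ is (the point set of) a line of the geometry. Its deficiency graph has the points of the geometry as vertices, with $x \sim y$ precisely when $x$ and $y$ are not collinear; it is $k$-regular with $(k-1)r + k + 1$ vertices. For a graph $G$, $N(x)$ denotes the (open) set of neighbours of $x$. A set $S \subseteq V(G)$ is an identifying code for $G$ if the sets $N(x) \cap S$, $x \in V(G)$, are pairwise distinct. For an identifying code $S$, $\pi_i(S)$ is the number of vertices $x$ of $G$ with $|N(x) \cap S| = i$. An identifying code $S$ for a $w$-regular graph with $v$ vertices is best possible if $|S| = \left\lceil 2(v-1)/(w+1) \right\rceil$. A (best possible) identifying code for a geometry is a (best possible) identifying code for its deficiency graph. *)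

(* Defs.v *)
From mathcomp Require Import all_boot all_order all_algebra.

Set Implicit Arguments.
Unset Strict Implicit.
Unset Printing Implicit Defensive.

Import Order.TTheory GRing.Theory Num.Theory.

(* A geometry with point set T is given by its set L of lines, a line being
   the set of points incident with it. *)

Definition partial_linear_space (T : finType) (L : {set {set T}}) : Prop :=
  forall l m : {set T}, l \in L -> m \in L ->
  forall x y : T, x != y ->
    x \in l -> y \in l -> x \in m -> y \in m -> l = m.

Definition collinear (T : finType) (L : {set {set T}}) : rel T :=
  fun x y => [exists l in L, (x \in l) && (y \in l)].

(* The empty geometry has to be excluded explicitly: it would satisfy all the
   other conditions vacuously, for all k and r. *)
Definition pentagonal_geometry
    (k r : nat) (T : finType) (L : {set {set T}}) : Prop :=
  [/\ 0 < #|T|,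
      partial_linear_space L,
      forall l : {set T}, l \in L -> #|l| = k,
      forall x : T, #|[set l in L | x \in l]| = r
    & forall x : T, [set y | ~~ collinear L x y] \in L].

Definition deficiency_graph (T : finType) (L : {set {set T}}) : rel T :=
  fun x y => ~~ collinear L x y.

(* Graphs are given by their adjacency relation, meant to be symmetric and
   irreflexive (as deficiency graphs are as soon as r > 0). *)

Definition nbhd (T : finType) (e : rel T) (x : T) : {set T} := [set y | e x y].

Definition regular_graph (w : nat) (T : finType) (e : rel T) : Prop :=
  forall x : T, #|nbhd e x| = w.

Definition connected_graph (T : finType) (e : rel T) : Prop :=
  forall x y : T, connect e x y.

(* The bound 2 < size c discards the closed walks [:: x; y] along one edge
   and the empty sequence, which are not cycles of a graph. *)
Definition girth_at_least (g : nat) (T : finType) (e : rel T) : Prop :=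
  forall c : seq T, ucycle e c -> 2 < size c -> g <= size c.

Definition identifying_code
    (T : finType) (e : rel T) (S : {set T}) : Prop :=
  injective (fun x : T => nbhd e x :&: S).

Definition code_pi
    (i : nat) (T : finType) (e : rel T) (S : {set T}) : nat :=
  #|[set x | #|nbhd e x :&: S| == i]|.

(* The quotient is taken in rat, so that Num.ceil is an honest ceiling. *)
Definition best_possible_code
    (w : nat) (T : finType) (e : rel T) (S : {set T}) : Prop :=
  [/\ regular_graph w e,
      identifying_code e S
    & #|S|%:Z%R
        = Num.ceil (2%:R * (#|T|%:R - 1) / (w%:R + 1) : rat)%R].

(* Main.v *)
Require Import Defs.
From mathcomp Require Import all_boot all_order all_algebra.

Set Implicit Arguments.
Unset Strict Implicit.
Unset Printing Implicit Defensive.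

Import Order.TTheory GRing.Theory Num.Theory.

(** For each [r] a geometry with [v = 3r + 5] points is given by base blocks,
    and everything asserted about it is reduced to a finite check.

    The points are the residues modulo [v] and the lines are the translates,
    by the multiples of a divisor [m] of [v], of some 4-subsets.  The first [m]
    base blocks are the lines opposite to the points [0], ..., [m - 1].  By
    translation it is enough to look at these [m] points: if [p], its opposite
    line and the lines through [p] deprived of [p] partition the point set, then
    every other point is on at most one line with [p], and the points that are
    not collinear with [p] are those of the opposite line.  This is
    [point_partition], from which [lines_are_pentagonal] follows.

    The girth comes for free.  The neighbours of [x] in the deficiency graph
    form a line, so two of them are collinear and there is no triangle.  If two
    points had two common neighbours, their opposite lines would share two
    points and so be equal, which an identifying code forbids: there is no
    4-cycle either ([girth_of_identifying_code]).

    Let [r = 5t] and [u = 3t + 1], so that [v = 5u].  The points are five layers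
    of a group of order [u]: the cyclic group, a dicyclic group, or, for
    [r = 65], a semidirect product of cyclic groups of orders 5 and 8.  The
    code consists of two layers: its size [2u] is the ceiling of
    [2(v - 1)/5].  The deficiency graph is chosen so that exactly two layers
    see the code once, in two different layers of it, while the points of the
    three others have two neighbours in it.  In the absence of 4-cycles such a
    code is identifying, and it dominates all the points.

    The lines are of two sorts.  Suppose that the differences of some quadruples
    of the group are all distinct (those of [0, u/4, u/2, 3u/4] are also allowed
    in the cyclic group of order [u], as a short orbit).  Blowing up each
    quadruple by five layers ([inflate], a transversal design) gives lines that
    cover exactly the pairs of points, in any layers, whose difference is one of
    these.  The few remaining differences are covered by the opposite lines and
    by further base blocks, the solution of a small exact cover problem.  In
    most cases these form orbits of one more automorphism: a change of layer, a
    multiplication in the group, or a unit of the cyclic group acting together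
    with a permutation of the layers.

    For [r = 13, 17, 21, 24] there are 4, 4, 4 and 11 layers of a cyclic group
    and no inflated blocks, and the code is an explicit list. *)

(** * Identifying codes, girth and best possible size *)

Lemma collinear_sym (T : finType) (L : {set {set T}}) : symmetric (collinear L).
Proof.
by move=> x y; apply: eq_existsb => l; rewrite [(x \in l) && _]andbC.
Qed.

Lemma girth_of_identifying_code (k r : nat) (T : finType) (L : {set {set T}})
    (S : {set T}) :
  pentagonal_geometry k r L -> identifying_code (deficiency_graph L) S ->
  girth_at_least 5 (deficiency_graph L).
Proof.
case=> _ pls _ _ opp idS c /andP[cyc_c uniq_c] c_gt2.
have esym x y : deficiency_graph L x y = deficiency_graph L y x.
  by rewrite /deficiency_graph collinear_sym.
have opp_lines x : nbhd (deficiency_graph L) x \in L by exact: opp.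
rewrite leqNgt; apply/negP => c_lt5.
case: c cyc_c uniq_c c_gt2 c_lt5 => [|x [|y [|z [|w [|? ?]]]]] //=.
  (* y and z are adjacent although both lie on the line N(x) *)
  rewrite !andbT => /and3P[exy eyz ezx] _ _ _.
  move/negP: eyz; apply; apply/existsP; exists (nbhd (deficiency_graph L) x).
  by rewrite opp_lines !inE exy esym ezx.
rewrite !andbT !inE !negb_or => /and4P[exy eyz ezw ewx].
case/and3P=> /and3P[_ xz _] /andP[_ yw] _ _ _.
(* the lines N(x) and N(z) share y and w *)
move/eqP: xz; apply; apply: idS; congr (_ :&: _).
apply: (pls _ _ (opp_lines x) (opp_lines z) y w yw); rewrite inE //.
- by rewrite esym.
- by rewrite esym.
Qed.

Lemma best_size_ceil (n s : nat) :
  0 < n -> 2 * n.-1 <= 5 * s < 2 * n.-1 + 5 ->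
  (s%:Z = Num.ceil (2%:R * (n%:R - 1) / (4%:R + 1) : rat))%R.
Proof.
case: n => // n _ /= /andP[lo hi].
have -> : (2%:R * (n.+1%:R - 1) / (4%:R + 1) = (2 * n)%:R / 5%:R :> rat)%R.
  by rewrite -[n.+1%:R%R]natr1 addrK natrM (natr1 4).
have s_int : (s%:Z%:~R = s%:R :> rat)%R by rewrite -pmulrn.
apply/esym/eqP; rewrite eq_le; apply/andP; split.
  rewrite ceil_le_int s_int ler_pdivrMr ?ltr0n // -natrM ler_nat.
  by rewrite [(s * 5)%N]mulnC.
rewrite -ltzD1 -ltrBlDr ceil_gt_int intrB s_int ltr_pdivlMr ?ltr0n //.
by rewrite mulrBl mul1r ltrBlDr -natrM -natrD ltr_nat [(s * 5)%N]mulnC.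
Qed.

(** * Translation-invariant line sets *)

(** Points are residues modulo [npoints]; lines are the translates of the blocks
    by the multiples of [step]; [nth [::] opposites p] is the line opposite to
    the point [p < step]. *)
Record plan := Plan {
  npoints : nat;
  lines_per_point : nat;
  step : nat;
  opposites : seq (seq nat);
  starters : seq (seq nat);
  code : pred nat }.

Definition shift (v c : nat) (s : seq nat) : seq nat :=
  [seq (x + c) %% v | x <- s].

Definition blocks (P : plan) : seq (seq nat) := opposites P ++ starters P.

Definition opposite (P : plan) (x : nat) : seq nat :=
  shift (npoints P) (x - x %% step P) (nth [::] (opposites P) (x %% step P)).

(** The lines through the point [p < step], as lists.  A line through [p] is the
    translate that moves some [q] of a block to [p], which requires [q] and [p]
    to agree modulo [step].  A block with a nontrivial stabilizer yields the
    same line several times, whence the sorting and the removal of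
    duplicates. *)
Definition star (P : plan) (p : nat) : seq (seq nat) :=
  undup [seq sort leq (shift (npoints P) (npoints P + p - q) B)
        | B <- blocks P, q <- [seq q <- B | q %% step P == p]].

(** Comparing the list of multiplicities with a constant list tests for a
    permutation of [iota 0 v] without sorting. *)
Definition tally (s : seq nat) : seq nat :=
  foldr (fun i t => incr_nth t i) [::] s.

Definition point_ok (P : plan) (p : nat) : bool :=
  (size (star P p) == lines_per_point P) &&
  (tally (p :: opposite P p ++ flatten [seq rem p l | l <- star P p])
     == nseq (npoints P) 1).

Definition block_ok (v : nat) (B : seq nat) : bool :=
  [&& size B == 4, uniq B & all (gtn v) B].

Definition geometry_ok (P : plan) : bool :=
  [&& 0 < npoints P, 0 < lines_per_point P, 0 < step P, step P %| npoints P,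
      size (opposites P) == step P, all (block_ok (npoints P)) (blocks P)
    & all (point_ok P) (iota 0 (step P))].

Definition point_set (v : nat) (s : seq nat) : {set 'I_v} :=
  [set x | val x \in s].

Definition lines (P : plan) : {set {set 'I_(npoints P)}} :=
  [set l | [exists c : 'I_(npoints P), (step P %| c) &&
     has (fun B => l == point_set (npoints P) (shift (npoints P) c B))
         (blocks P)]].

Lemma eq_shift v c d s : c = d %[mod v] -> shift v c s = shift v d s.
Proof.
by move=> cd; apply: eq_map => x; apply/eqP; rewrite eqn_modDl; apply/eqP.
Qed.

Lemma shift_shift v c d s : shift v c (shift v d s) = shift v (d + c) s.
Proof.
by rewrite /shift -map_comp; apply: eq_map => x /=; rewrite modnDml addnA.
Qed.

Lemma shift_bound v c s : 0 < v -> all (gtn v) (shift v c s).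
Proof.
by move=> v0; rewrite all_map; apply/allP => x _ /=; rewrite ltn_mod.
Qed.

Lemma mem_shift v c s y : c <= v -> all (gtn v) s -> y < v ->
  (y \in shift v c s) = ((y + (v - c)) %% v \in s).
Proof.
move=> cv /allP sv yv; apply/mapP/idP => [[x xs ->]|ys].
  by rewrite modnDml -addnA subnKC // modnDr modn_small //; apply: sv.
exists ((y + (v - c)) %% v) => //.
by rewrite modnDml -addnA subnK // modnDr modn_small.
Qed.

Lemma shift_uniq v c s : all (gtn v) s -> uniq s -> uniq (shift v c s).
Proof.
move=> /allP sv us; rewrite map_inj_in_uniq // => x y /sv /= xv /sv /= yv /eqP.
by rewrite eqn_modDr !modn_small // => /eqP.
Qed.

Lemma count_tally s i : nth 0 (tally s) i = count_mem i s.
Proof. by elim: s => [|x s IH] /=; rewrite ?nth_nil ?nth_incr_nth ?IH. Qed.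

Lemma perm_tally s v : tally s = nseq v 1 -> perm_eq s (iota 0 v).
Proof.
move=> ts; apply/allP => i _ /=; rewrite -count_tally ts nth_nseq.
by rewrite count_uniq_mem ?iota_uniq // mem_iota add0n leq0n /=; case: ifP.
Qed.

Lemma uniq_flatten_map_inj (A B : eqType) (f : A -> seq B) (s : seq A) a b y :
  uniq (flatten [seq f x | x <- s]) ->
  a \in s -> b \in s -> y \in f a -> y \in f b -> a = b.
Proof.
elim: s => //= x s IH; rewrite cat_uniq => /and3P[_ /hasPn dis us].
have out c : c \in s -> y \in f c -> y \in f x -> False.
  move=> cs yc yx; have /dis/negP : y \in flatten [seq f x | x <- s].
    by apply/flatten_mapP; exists c.
  exact.
rewrite !inE => /predU1P[->|as_] /predU1P[->|bs] ya yb //.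
- by case: (out b).
- by case: (out a).
- exact: IH.
Qed.

Lemma card_point_set v s : all (gtn v) s -> uniq s -> #|point_set v s| = size s.
Proof.
move=> /allP sv us; rewrite cardE -(size_map val).
apply/perm_size/uniq_perm => //.
  by rewrite map_inj_uniq ?enum_uniq //; apply: val_inj.
move=> x; apply/mapP/idP => [[y] | xs]; first by rewrite mem_enum inE => ys ->.
by exists (Ordinal (sv x xs)); rewrite ?mem_enum ?inE.
Qed.

Lemma block_bound P B : geometry_ok P -> B \in blocks P ->
  [/\ size B = 4, uniq B & all (gtn (npoints P)) B].
Proof.
case/and5P=> _ _ _ _ /and3P[_ /allP ok _] BP.
by have /and3P[/eqP] := ok _ BP.
Qed.

Lemma star_block P p s : geometry_ok P -> p < npoints P -> s \in star P p ->
  [/\ size s = 4, uniq s, all (gtn (npoints P)) s & p \in s].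
Proof.
move=> ok pv; rewrite mem_undup => /allpairsPdep[B [q []]] BP.
rewrite mem_filter => /andP[_ qB] ->.
have [sB uB /[dup] bB /allP/(_ _ qB)/= qv] := block_bound ok BP.
have v0 : 0 < npoints P by exact: leq_ltn_trans pv.
rewrite size_sort size_map sort_uniq shift_uniq // mem_sort; split => //.
  by rewrite all_sort shift_bound.
apply/mapP; exists q => //.
by rewrite subnKC ?modnDl ?modn_small // (leq_trans (ltnW qv)) ?leq_addr.
Qed.

(** This one partition yields both the uniqueness of the line through two points
    and the description of the points not collinear with [p]. *)
Lemma point_partition P p : geometry_ok P -> p < step P ->
  perm_eq (p :: opposite P p ++ flatten [seq rem p l | l <- star P p])
          (iota 0 (npoints P)).
Proof.
case/and5P=> _ _ _ _ /and3P[_ _ /allP ok] pm; apply: perm_tally.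
have /ok/andP[_ /eqP //] : p \in iota 0 (step P) by rewrite mem_iota.
Qed.

Lemma star_rem P p s i : geometry_ok P -> p < npoints P -> s \in star P p ->
  (i \in rem p s) = (i != p) && (i \in s).
Proof. by move=> ok pv /(star_block ok pv)[_ us _ _]; rewrite mem_rem_uniq. Qed.

Lemma star_disjoint P p s t i : geometry_ok P -> p < step P ->
  s \in star P p -> t \in star P p -> i \in rem p s -> i \in rem p t -> s = t.
Proof.
move=> ok pm; have := perm_uniq (point_partition ok pm).
rewrite iota_uniq /= cat_uniq => /and4P[_ _ _ uF].
exact: uniq_flatten_map_inj.
Qed.

(** * The geometry seen from an arbitrary point *)

Lemma step_dvd_base P x : step P %| x - x %% step P.
Proof. by rewrite {1}(divn_eq x (step P)) addnK dvdn_mull. Qed.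

Lemma residue_lt P (x : 'I_(npoints P)) : x %% step P < npoints P.
Proof. exact: leq_ltn_trans (leq_mod _ _) (ltn_ord x). Qed.

(** The preimage of [y] under the translation that carries [x %% step] to [x].
    That translation is an automorphism, so the lines through [x] can be read
    off the star of [x %% step]. *)
Definition pullback P (x y : 'I_(npoints P)) : nat :=
  (y + (npoints P - (x - x %% step P))) %% npoints P.

Lemma pullback_lt P (x y : 'I_(npoints P)) : pullback x y < npoints P.
Proof. by rewrite ltn_mod (leq_ltn_trans (leq0n _) (ltn_ord x)). Qed.

Lemma pullback_inj P (x : 'I_(npoints P)) : injective (pullback x).
Proof.
move=> y z /eqP; rewrite eqn_modDr !modn_small ?ltn_ord // => /eqP.
exact: val_inj.
Qed.

Lemma pullback_self_mod P (x : 'I_(npoints P)) :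
  (x + (npoints P - (x - x %% step P))) %% npoints P = x %% step P.
Proof.
have xv := ltn_ord x.
rewrite addnBA ?(leq_trans (leq_subr _ _)) 1?ltnW // addnC -addnBA ?leq_subr //.
by rewrite subKn ?leq_mod // modnDl modn_small // (leq_ltn_trans (leq_mod _ _)).
Qed.

Lemma pullback_self P (x : 'I_(npoints P)) : pullback x x = x %% step P.
Proof. exact: pullback_self_mod. Qed.

Lemma pullback_onto P (x : 'I_(npoints P)) i : i < npoints P ->
  exists y, pullback x y = i.
Proof.
move=> iv; have v0 : 0 < npoints P by exact: leq_ltn_trans iv.
exists (Ordinal (ltn_pmod (i + (x - x %% step P)) v0)).
rewrite /pullback /= modnDml -addnA subnKC; first by rewrite modnDr modn_small.
by rewrite (leq_trans (leq_subr _ _)) // ltnW.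
Qed.

Lemma mem_translate P (x : 'I_(npoints P)) s (y : 'I_(npoints P)) :
  all (gtn (npoints P)) s ->
  (y \in point_set (npoints P) (shift (npoints P) (x - x %% step P) s)) =
  ((y + (npoints P - (x - x %% step P))) %% npoints P \in s).
Proof.
move=> sv; rewrite inE mem_shift ?ltn_ord //.
by rewrite (leq_trans (leq_subr _ _)) // ltnW.
Qed.

Lemma mem_star_line P (x y : 'I_(npoints P)) s : geometry_ok P ->
  s \in star P (x %% step P) ->
  (y \in point_set (npoints P) (shift (npoints P) (x - x %% step P) s)) =
  (pullback x y \in s).
Proof.
by move=> ok /(star_block ok (residue_lt x))[_ _ bs _]; rewrite mem_translate.
Qed.

Lemma star_line P (x : 'I_(npoints P)) s : geometry_ok P ->
  s \in star P (x %% step P) ->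
  point_set (npoints P) (shift (npoints P) (x - x %% step P) s) \in lines P.
Proof.
move=> ok; have [v0 _ m0 mv _] := and5P ok.
rewrite mem_undup => /allpairsPdep[B [q []]] BP.
rewrite mem_filter => /andP[/eqP qm qB] ->.
have [_ _ /allP/(_ _ qB)/= qv] := block_bound ok BP.
rewrite inE; apply/existsP.
set d := npoints P + x %% step P - q; set c := x - x %% step P.
exists (Ordinal (ltn_pmod (d + c) v0)) => /=.
have qd : q <= npoints P + x %% step P.
  by rewrite (leq_trans (ltnW qv)) ?leq_addr.
rewrite /dvdn modn_dvdm // -/(dvdn _ _) dvdn_add ?step_dvd_base //=; last first.
  by rewrite -eqn_mod_dvd // -modnDml (eqP mv) add0n modn_mod qm.
apply/hasP; exists B => //; apply/eqP/setP => y; rewrite !inE.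
rewrite (eq_shift (c := (d + c) %% npoints P) (d := d + c)) ?modn_mod //.
rewrite -shift_shift.
by apply: eq_mem_map => z; rewrite mem_sort.
Qed.

Lemma line_star P (x : 'I_(npoints P)) l : geometry_ok P ->
  l \in lines P -> x \in l ->
  exists2 s, s \in star P (x %% step P) &
    l = point_set (npoints P) (shift (npoints P) (x - x %% step P) s).
Proof.
move=> ok; have [v0 _ m0 mv _] := and5P ok.
rewrite inE => /existsP[c /andP[mc /hasP[B BP /eqP ->]]].
rewrite inE => /mapP[q qB xq].
have [_ _ /allP/(_ _ qB)/= qv] := block_bound ok BP.
have qm : q %% step P = x %% step P.
  by rewrite xq modn_dvdm // -modnDmr (eqP mc) addn0.
exists (sort leq (shift (npoints P) (npoints P + x %% step P - q) B)).
  rewrite mem_undup; apply/allpairsPdep; exists B, q; split=> //.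
  by rewrite mem_filter qB qm eqxx.
apply/setP => y; rewrite !inE.
set d := npoints P + x %% step P - q.
rewrite (eq_shift (c := c) (d := d + (x - x %% step P))).
  by rewrite -shift_shift; apply: eq_mem_map => z; rewrite mem_sort.
apply/eqP; rewrite -(eqn_modDl q) -xq addnA subnKC; last first.
  by rewrite (leq_trans (ltnW qv)) ?leq_addr.
by rewrite -addnA subnKC ?leq_mod // modnDl modn_small.
Qed.

Lemma opposite_base P p : geometry_ok P -> p < step P ->
  opposite P p = nth [::] (opposites P) p.
Proof.
move=> ok pm; rewrite /opposite modn_small // subnn /shift.
case/and5P: (ok) => v0 _ _ _ /and3P[/eqP sz _ _].
have /(block_bound ok)[_ _ /allP bB] : nth [::] (opposites P) p \in blocks P.
  by rewrite mem_cat mem_nth ?sz.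
by rewrite -[RHS]map_id; apply/eq_in_map => z /bB zv; rewrite addn0 modn_small.
Qed.

Lemma mem_opposite P (x y : 'I_(npoints P)) : geometry_ok P ->
  (val y \in opposite P x) = (pullback x y \in opposite P (x %% step P)).
Proof.
move=> ok; case/and5P: (ok) => v0 _ m0 _ /and3P[/eqP sz _ _].
have pm := ltn_pmod x m0.
rewrite (opposite_base ok pm) /pullback -mem_translate ?inE //.
have [] // := @block_bound P (nth [::] (opposites P) (x %% step P)) ok.
by rewrite mem_cat mem_nth ?sz.
Qed.

Lemma not_collinear P (x y : 'I_(npoints P)) : geometry_ok P ->
  ~~ collinear (lines P) x y = (val y \in opposite P x).
Proof.
move=> ok; case/and5P: (ok) => v0 r0 m0 mv /and3P[_ _ /allP sizes].
have pm := ltn_pmod x m0; have pv := residue_lt x.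
set p := x %% step P in pm pv *.
have part := point_partition ok pm.
have := perm_uniq part; rewrite iota_uniq /= mem_cat negb_or cat_uniq.
case/and4P=> /andP[p_opp p_rem] _ dis _; rewrite mem_opposite //.
apply/negP/idP => [ncol | yopp].
  have := perm_mem part (pullback x y).
  rewrite mem_iota leq0n pullback_lt inE mem_cat.
  have [yp _ | _] := eqVneq (pullback x y) p.
    have /sizes/andP[/eqP szS _] : p \in iota 0 (step P) by rewrite mem_iota.
    have [s sS] : exists s, s \in star P p.
      by case: (star P p) szS r0 => [<- //|s S _ _]; exists s; rewrite mem_head.
    have [_ _ _ ps] := star_block ok pv sS.
    case: ncol; apply/existsP.
    exists (point_set _ (shift (npoints P) (x - x %% step P) s)).
    by rewrite star_line // !mem_star_line // pullback_self yp ps.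
  rewrite orFb => /orP[//|/flatten_mapP[s sS]].
  rewrite (star_rem _ ok pv sS) => /andP[_ ys].
  have [_ _ _ ps] := star_block ok pv sS.
  case: ncol; apply/existsP.
  exists (point_set _ (shift (npoints P) (x - x %% step P) s)).
  by rewrite star_line // !mem_star_line // pullback_self ps.
case/existsP=> l /and3P[lL xl yl]; have [s sS ls] := line_star ok lL xl.
move: yl; rewrite ls mem_star_line // => ys.
move/hasPn: dis => /(_ (pullback x y)) => dis.
have /dis/negP[] // : pullback x y \in flatten [seq rem p l | l <- star P p].
apply/flatten_mapP; exists s => //; rewrite (star_rem _ ok pv sS) ys andbT.
by apply: contraNneq p_opp => cp; rewrite -{1}cp.
Qed.

Lemma deficiency_nbhd P (x : 'I_(npoints P)) : geometry_ok P ->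
  nbhd (deficiency_graph (lines P)) x = point_set (npoints P) (opposite P x).
Proof. by move=> ok; apply/setP => y; rewrite !inE -not_collinear. Qed.

Lemma lines_are_pentagonal P : geometry_ok P ->
  pentagonal_geometry 4 (lines_per_point P) (lines P).
Proof.
move=> ok; case/and5P: (ok) => v0 r0 m0 mv /and3P[/eqP sz _ /allP sizes].
split=> [|l1 l2 l1L l2L x y xy xl1 yl1 xl2 yl2|l|x|x].
- by rewrite card_ord.
- have pm := ltn_pmod x m0; have pv := residue_lt x.
  have [s1 s1S e1] := line_star ok l1L xl1.
  have [s2 s2S e2] := line_star ok l2L xl2.
  rewrite e1 e2; congr (point_set _ (shift _ _ _)).
  have yp : pullback x y != x %% step P.
    by apply: contraNneq xy; rewrite -pullback_self => /pullback_inj ->.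
  apply: (star_disjoint (i := pullback x y) ok pm s1S s2S).
    by rewrite (star_rem _ ok pv s1S) yp -mem_star_line // -e1.
  by rewrite (star_rem _ ok pv s2S) yp -mem_star_line // -e2.
- rewrite inE => /existsP[c /andP[_ /hasP[B BP /eqP ->]]].
  have [sB uB bB] := block_bound ok BP.
  by rewrite card_point_set ?shift_uniq ?shift_bound // size_map.
- have pm := ltn_pmod x m0; have pv := residue_lt x.
  have /sizes/andP[/eqP <- _] : x %% step P \in iota 0 (step P).
    by rewrite mem_iota.
  set f := fun s =>
    point_set (npoints P) (shift (npoints P) (x - x %% step P) s).
  rewrite -(size_map f).
  have /card_uniqP <- : uniq [seq f s | s <- star P (x %% step P)].
    (* equal lines share a point other than x, which only one line of the star
       of x %% step contains *)
    rewrite map_inj_in_uniq ?undup_uniq // => s t sS tS est.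
    have [szs us /allP bs ps] := star_block ok pv sS.
    have [i irem] : exists i, i \in rem (x %% step P) s.
      case: (rem _ _) (size_rem ps) => [|i s' _]; first by rewrite szs.
      by exists i; rewrite mem_head.
    have := irem; rewrite (star_rem _ ok pv sS) => /andP[ip is_].
    have [y yi] := pullback_onto x (bs _ is_).
    apply: (star_disjoint ok pm sS tS irem).
    rewrite (star_rem _ ok pv tS) ip -yi -mem_star_line // -/(f t) -est.
    by rewrite mem_star_line // yi.
  apply: eq_card => l; rewrite inE; apply/andP/mapP => [[lL xl]|[s sS ->]].
    by have [s sS es] := line_star ok lL xl; exists s.
  have [_ _ _ ps] := star_block ok pv sS.
  by rewrite star_line // mem_star_line // pullback_self.
- have -> : [set y | ~~ collinear (lines P) x y] = point_set _ (opposite P x).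
    by rewrite -deficiency_nbhd.
  rewrite inE; apply/existsP.
  have cv : x - x %% step P < npoints P.
    exact: leq_ltn_trans (leq_subr _ _) (ltn_ord x).
  exists (Ordinal cv); rewrite step_dvd_base /=; apply/hasP.
  exists (nth [::] (opposites P) (x %% step P)) => //.
  by rewrite mem_cat mem_nth ?sz ?ltn_pmod.
Qed.

(** * Checking the code and the connectedness *)

Definition trace (P : plan) (x : nat) : seq nat :=
  sort leq [seq y <- opposite P x | code P y].

Definition dominated (P : plan) (x : nat) : bool := has (code P) (opposite P x).

(** Points with the same nonempty trace on the code are neighbours of a common
    point of the code, so traces need only be compared within the
    neighbourhoods of the points of the code; besides, one trace at most may be
    empty. *)
Definition code_ok (P : plan) : bool :=
  let s := count (code P) (iota 0 (npoints P)) in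
  [&& all (fun z => code P z ==> uniq [seq trace P x | x <- opposite P z])
          (iota 0 (npoints P)),
      count (predC (dominated P)) (iota 0 (npoints P)) <= 1
    & 2 * (npoints P).-1 <= 5 * s < 2 * (npoints P).-1 + 5].

Definition dominating (P : plan) : bool :=
  all (dominated P) (iota 0 (npoints P)).

Definition code_set P : {set 'I_(npoints P)} := [set x | code P (val x)].

Lemma card_code_set P : #|code_set P| = count (code P) (iota 0 (npoints P)).
Proof.
by rewrite cardsE cardE -val_enum_ord count_map -size_filter enumT.
Qed.

Lemma mem_trace P x y : (y \in trace P x) = code P y && (y \in opposite P x).
Proof. by rewrite mem_sort mem_filter. Qed.

Lemma trace_uniq P (x : 'I_(npoints P)) : geometry_ok P -> uniq (trace P x).
Proof.
move=> ok; case/and5P: (ok) => v0 _ m0 _ /and3P[/eqP sz _ _].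
have /(block_bound ok)[_ uB bB] :
    nth [::] (opposites P) (x %% step P) \in blocks P.
  by rewrite mem_cat mem_nth ?sz ?ltn_pmod.
by rewrite sort_uniq filter_uniq ?shift_uniq.
Qed.

Lemma opposite_sym P (x y : 'I_(npoints P)) : geometry_ok P ->
  (val x \in opposite P y) = (val y \in opposite P x).
Proof. by move=> ok; rewrite -!not_collinear // collinear_sym. Qed.

Lemma uniq_map_inj (A B : eqType) (f : A -> B) (s : seq A) x y :
  uniq [seq f z | z <- s] -> x \in s -> y \in s -> f x = f y -> x = y.
Proof.
elim: s => //= z s IH /andP[zs us]; rewrite !inE.
case/predU1P=> [-> | xs] /predU1P[-> | ys] // fxy; last exact: IH.
  by case/negP: zs; rewrite fxy map_f.
by case/negP: zs; rewrite -fxy map_f.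
Qed.

Lemma eq_trace P (x y : 'I_(npoints P)) : geometry_ok P ->
  point_set (npoints P) (opposite P x) :&: code_set P =
  point_set (npoints P) (opposite P y) :&: code_set P -> trace P x = trace P y.
Proof.
move=> ok /setP exy; apply: (sorted_eq leq_trans anti_leq).
- exact/sort_sorted/leq_total.
- exact/sort_sorted/leq_total.
apply: uniq_perm; rewrite ?trace_uniq // => z; rewrite !mem_trace.
have [zv | vz] := ltnP z (npoints P).
  by have := exy (Ordinal zv); rewrite !inE ![_ && code P z]andbC.
have outside (w : 'I_(npoints P)) : z \in opposite P w = false.
  have v0 : 0 < npoints P by exact: leq_ltn_trans (ltn_ord w).
  by apply: contraTF vz => /(allP (shift_bound _ _ v0)) /=; rewrite ltnNge.
by rewrite !outside.
Qed.

Lemma code_identifies P : geometry_ok P -> code_ok P ->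
  identifying_code (deficiency_graph (lines P)) (code_set P).
Proof.
move=> ok /and3P[/allP local few _] x y; rewrite !deficiency_nbhd //.
move/(eq_trace ok) => txy; have v0 : 0 < npoints P by case/andP: ok.
have all_pts (w : 'I_(npoints P)) : val w \in iota 0 (npoints P).
  by rewrite mem_iota ltn_ord.
apply: val_inj; have [/hasP[z zx cz] | ndx] := boolP (dominated P x).
  have zv := allP (shift_bound _ _ v0) _ zx : z < npoints P.
  have zy : z \in opposite P y.
    by have := mem_trace P y z; rewrite -txy mem_trace zx cz.
  have /implyP/(_ cz) inj := local _ (all_pts (Ordinal zv)).
  by apply: uniq_map_inj inj _ _ txy; rewrite (opposite_sym _ (Ordinal zv)).
(* x and y both have an empty trace, so they are the same point *)
have ndy : ~~ dominated P y.
  apply: contra ndx => /hasP[z zy cz]; apply/hasP; exists z => //.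
  by have := mem_trace P x z; rewrite txy mem_trace zy cz.
apply/eqP; apply: contraTT few => xy; rewrite -ltnNge -size_filter.
apply: (@uniq_leq_size _ [:: val x; val y]); first by rewrite /= inE xy.
move=> z; rewrite !inE mem_filter.
by move=> /orP[] /eqP ->; rewrite /= all_pts ?ndx ?ndy.
Qed.

Lemma code_is_best_possible P : geometry_ok P -> code_ok P ->
  best_possible_code 4 (deficiency_graph (lines P)) (code_set P).
Proof.
move=> ok ck; case/and3P: (ck) => _ _ bounds; have [v0 _ _ _ _] := and5P ok.
have [_ _ sz _ opp] := lines_are_pentagonal ok.
split; [by move=> x; apply: sz; apply: opp | exact: code_identifies |].
by rewrite card_ord card_code_set; apply: best_size_ceil.
Qed.

Lemma dominating_pi0 P : geometry_ok P -> dominating P ->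
  code_pi 0 (deficiency_graph (lines P)) (code_set P) = 0.
Proof.
move=> ok /allP dom; apply/eqP; rewrite cards_eq0; apply/eqP/setP => x.
rewrite !inE; apply/negbTE; rewrite cards_eq0 deficiency_nbhd //; apply/set0Pn.
have /dom/hasP[y yx cy] : val x \in iota 0 (npoints P).
  by rewrite mem_iota ltn_ord.
have yv : y < npoints P.
  by have /andP[v0 _] := ok; apply: (allP (shift_bound _ _ v0)) yx.
by exists (Ordinal yv); rewrite !inE yx.
Qed.

Definition spread (v : nat) (nbrs : seq (seq nat)) (seen : bitseq) : bitseq :=
  mkseq (fun x => nth false seen x || has (nth false seen) (nth [::] nbrs x)) v.

(** Breadth-first search from the point 0, which is at distance at most 16 from
    every other point in all the deficiency graphs below. *)
Definition connected_ok (P : plan) : bool :=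
  let v := npoints P in
  all id (iter 16 (spread v (mkseq (opposite P) v)) (true :: nseq v.-1 false)).

Lemma spread_connected P (x : 'I_(npoints P)) seen : geometry_ok P ->
  (forall y : 'I_(npoints P), nth false seen y ->
     connect (deficiency_graph (lines P)) x y) ->
  forall y : 'I_(npoints P),
     nth false (spread (npoints P) (mkseq (opposite P) (npoints P)) seen) y ->
     connect (deficiency_graph (lines P)) x y.
Proof.
move=> ok seenP y; rewrite nth_mkseq ?ltn_ord // => /orP[/seenP // | /hasP[z]].
rewrite nth_mkseq ?ltn_ord // => zy sz.
have zv : z < npoints P.
  by have /andP[v0 _] := ok; apply: (allP (shift_bound _ _ v0)) zy.
apply: connect_trans (seenP (Ordinal zv) sz) (connect1 _).
by rewrite /deficiency_graph collinear_sym not_collinear.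
Qed.

Lemma plan_connected P : geometry_ok P -> connected_ok P ->
  connected_graph (deficiency_graph (lines P)).
Proof.
move=> ok /allP conn; have [v0 _ _ _ _] := and5P ok.
have from0 (y : 'I_(npoints P)) :
    connect (deficiency_graph (lines P)) (Ordinal v0) y.
  have : nth false (iter 16 (spread (npoints P)
                               (mkseq (opposite P) (npoints P)))
                      (true :: nseq (npoints P).-1 false)) y.
    by apply: conn; rewrite mem_nth // iterS size_mkseq.
  move: y; elim: 16 => [y | n IH]; last exact: spread_connected.
  case: y => [[|y]] yv /=; rewrite ?nth_nseq; last by case: ifP.
  by move=> _; apply: eq_connect0; apply: val_inj.
move=> x y; apply: connect_trans (from0 y).
rewrite (sym_connect_sym _) // => a b.
by rewrite /deficiency_graph collinear_sym.
Qed.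

Definition plan_ok (P : plan) : bool :=
  [&& geometry_ok P, code_ok P & connected_ok P].

Lemma plan_sound P : plan_ok P ->
  exists (T : finType) (L : {set {set T}}) (S : {set T}),
    [/\ pentagonal_geometry 4 (lines_per_point P) L,
        connected_graph (deficiency_graph L),
        girth_at_least 5 (deficiency_graph L),
        best_possible_code 4 (deficiency_graph L) S
      & dominating P -> code_pi 0 (deficiency_graph L) S = 0].
Proof.
case/and3P=> ok ck conn; exists 'I_(npoints P), (lines P), (code_set P).
have pent := lines_are_pentagonal ok; split=> //.
- exact: plan_connected.
- exact: girth_of_identifying_code pent (code_identifies ok ck).
- exact: code_is_best_possible.
- exact: dominating_pi0.
Qed.

(** * Tools for writing base blocks *)

(** The images of blocks under an automorphism [f] of order [k] modulo the
    translations. *)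
Definition orbits (k : nat) (f : nat -> nat) (Bs : seq (seq nat)) :
    seq (seq nat) :=
  [seq [seq iter j f x | x <- B] | j <- iota 0 k, B <- Bs].

(** The point [m * y + i] is the element [y] of Z_u in the layer [i < m].  This
    map multiplies by the unit [a] and permutes the layers by [s]. *)
Definition multiplier (m u a : nat) (s : seq nat) (x : nat) : nat :=
  m * ((a * (x %/ m)) %% u) + nth 0 s (x %% m).

(** Five layers, the group element labelled [b] giving the points [5 * b + i].
    The offsets [i + t * 2 ^ j] modulo 5, for [j < 4] and all [i] and [t], are
    25 words any two of which agree in one place at most: the 25 blocks over a
    quadruple join each point over an element of it exactly once to each point
    over another.  The factor [2 ^ j] makes this set of words invariant under
    the cyclic shift of the places, since 2 has order 4 modulo 5; therefore a
    quadruple [0, u/4, u/2, 3u/4] of Z_u, which the translation by [u/4]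
    rotates, is inflated to a set of blocks that is invariant too. *)
Definition inflate (Bs : seq (seq nat)) : seq (seq nat) :=
  [seq [seq 5 * w.1 + (c.1 + c.2 * w.2) %% 5 | w <- zip B [:: 1; 2; 4; 3]]
  | B <- Bs, c <- [seq (i, t) | i <- iota 0 5, t <- iota 0 5]].

Definition next_layer (x : nat) : nat := 5 * (x %/ 5) + (x %% 5).+1 %% 5.

(** In the dicyclic group of order [4 * n], where [r ^ (2 * n) = 1],
    [s ^ 2 = r ^ n] and [s * r = r ^ -1 * s], the element [r ^ y * s ^ f] of the
    layer [i] is the point [10 * y + 5 * f + i].  This is the multiplication by
    [s] on the left; the multiplication by [r] is the translation by 10. *)
Definition dicyclic_flip (n x : nat) : nat :=
  let f := (x %/ 5) %% 2 in
  10 * ((n * 2 - x %/ 10 + n * f) %% (2 * n)) + 5 * (1 - f) + x %% 5.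

(** In the group generated by [z] of order 8 and [r] of order 5 with
    [r * z = z * r ^ -1], the element [z ^ y * r ^ a] of the layer [i] is the
    point [5 * w + a], where [w] modulo 40 is congruent to [y] modulo 8 and to
    [i] modulo 5.  This is the multiplication by [r] on the left; multiplying by
    [z] and changing the layer generate the translations by 5. *)
Definition semidirect_flip (x : nat) : nat :=
  5 * (x %/ 5) + (x + (if odd (x %/ 5) then 4 else 1)) %% 5.

(** * The 22 geometries *)

Definition plan13 : plan := Plan 44 13 4
   [:: [:: 4; 23; 35; 40]; [:: 17; 26; 29; 43]; [:: 11; 21; 22; 26];
        [:: 5; 12; 24; 38]]
   ([:: [:: 0; 10; 24; 42]; [:: 0; 6; 22; 43]; [:: 2; 3; 27; 43];
        [:: 0; 1; 9; 11]; [:: 0; 2; 17; 38]; [:: 0; 3; 34; 41];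
        [:: 0; 7; 15; 21]; [:: 0; 5; 16; 29]; [:: 1; 5; 18; 23]])
   (mem ([:: 0; 1; 3; 4; 7; 9; 13; 15; 17; 21; 34; 36; 37; 38; 39; 40;
             41; 43] : seq nat)).

Definition plan17 : plan := Plan 56 17 4
   [:: [:: 16; 39; 40; 53]; [:: 4; 10; 15; 51]; [:: 6; 23; 49; 54];
        [:: 9; 20; 38; 45]]
   ([:: [:: 0; 15; 26; 27]; [:: 0; 2; 36; 44]; [:: 0; 10; 30; 54];
        [:: 0; 19; 42; 51]; [:: 0; 4; 9; 50]; [:: 1; 18; 47; 55];
        [:: 1; 22; 35; 38]; [:: 0; 3; 41; 43]; [:: 0; 31; 38; 49];
        [:: 0; 17; 21; 29]; [:: 0; 1; 33; 34]; [:: 1; 7; 11; 41];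
        [:: 0; 7; 28; 35]; [:: 1; 26; 29; 54]])
   (mem ([:: 0; 1; 2; 5; 9; 11; 14; 16; 17; 19; 23; 26; 27; 30; 32; 33;
             35; 42; 46; 48; 49; 51] : seq nat)).

Definition plan20 : plan := Plan 65 20 5
   [:: [:: 6; 13; 22; 54]; [:: 7; 9; 58; 60]; [:: 13; 14; 45; 61];
        [:: 11; 34; 55; 57]; [:: 15; 38; 57; 61]]
   ([:: [:: 2; 3; 8; 42]; [:: 0; 7; 20; 57]; [:: 0; 27; 32; 48];
        [:: 0; 3; 10; 15]; [:: 3; 9; 13; 53]; [:: 2; 12; 39; 47];
        [:: 0; 49; 59; 62]; [:: 0; 4; 18; 40]; [:: 0; 19; 24; 39];
        [:: 3; 14; 23; 49]; [:: 0; 8; 26; 38]; [:: 1; 4; 22; 44];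
        [:: 0; 17; 31; 35]; [:: 0; 9; 11; 41]; [:: 1; 3; 32; 39];
        [:: 1; 2; 41; 63]; [:: 0; 1; 28; 56]; [:: 0; 36; 51; 64];
        [:: 1; 6; 42; 59]; [:: 1; 12; 21; 53]])
   (fun x => x %% 5 < 2).

Definition plan21 : plan := Plan 68 21 4
   [:: [:: 1; 24; 44; 47]; [:: 0; 29; 41; 66]; [:: 5; 6; 27; 66];
        [:: 24; 31; 43; 46]]
   ([:: [:: 1; 9; 25; 63]; [:: 1; 11; 35; 43]; [:: 1; 3; 19; 21];
        [:: 1; 7; 14; 27]; [:: 1; 6; 15; 46]; [:: 0; 33; 50; 65];
        [:: 0; 5; 35; 46]; [:: 0; 4; 10; 43]; [:: 0; 17; 21; 28];
        [:: 2; 7; 34; 58]; [:: 0; 26; 27; 37]; [:: 0; 15; 38; 52];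
        [:: 0; 9; 42; 58]; [:: 0; 11; 12; 30]; [:: 0; 8; 59; 63];
        [:: 0; 2; 36; 49]; [:: 0; 14; 53; 62]])
   (mem ([:: 0; 4; 5; 9; 12; 14; 20; 22; 26; 28; 30; 33; 35; 36; 37; 39;
             40; 41; 44; 46; 50; 52; 54; 58; 62; 63; 67] : seq nat)).

Definition plan24 : plan := Plan 77 24 11
   [:: [:: 16; 19; 32; 73]; [:: 25; 28; 54; 63]; [:: 21; 39; 48; 51];
        [:: 9; 18; 39; 56]; [:: 9; 30; 35; 73]; [:: 9; 50; 63; 66];
        [:: 38; 46; 47; 56]; [:: 11; 15; 35; 69]; [:: 23; 27; 59; 66];
        [:: 3; 4; 5; 10]; [:: 9; 34; 55; 68]]
   (orbits 3 (multiplier 11 7 2 [:: 1; 2; 0; 4; 5; 3; 7; 8; 6; 9; 10])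
    [:: [:: 3; 7; 25; 73]; [:: 3; 8; 29; 74]; [:: 0; 36; 50; 69];
        [:: 0; 17; 18; 48]; [:: 0; 3; 14; 59]; [:: 0; 40; 62; 71];
        [:: 6; 43; 51; 63]; [:: 3; 21; 49; 70]; [:: 0; 10; 15; 29];
        [:: 0; 7; 12; 26]; [:: 0; 5; 22; 43]; [:: 0; 11; 63; 65];
        [:: 0; 25; 37; 76]; [:: 0; 2; 33; 41]; [:: 0; 27; 51; 53];
        [:: 0; 23; 64; 68]; [:: 0; 42; 45; 57]; [:: 6; 21; 31; 54];
        [:: 0; 6; 30; 75]; [:: 0; 9; 28; 49]; [:: 3; 31; 37; 64]])
   (mem ([:: 1; 3; 11; 13; 15; 20; 21; 22; 24; 27; 28; 29; 32; 33; 36;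
             38; 40; 52; 54; 55; 56; 57; 58; 61; 62; 64; 66; 68; 71; 72;
             76] : seq nat)).

Definition plan25 : plan := Plan 80 25 5
   [:: [:: 4; 13; 46; 77]; [:: 2; 34; 35; 68]; [:: 1; 5; 58; 59];
        [:: 16; 27; 29; 70]; [:: 0; 27; 51; 58]]
   ([:: [:: 1; 7; 16; 52]; [:: 0; 7; 17; 32]; [:: 0; 2; 16; 48];
        [:: 0; 31; 36; 66]; [:: 1; 17; 18; 47]; [:: 0; 68; 72; 78];
        [:: 0; 8; 11; 38]; [:: 1; 27; 38; 53]; [:: 0; 3; 10; 28];
        [:: 1; 3; 11; 19]; [:: 0; 6; 9; 15]; [:: 0; 52; 57; 69];
        [:: 2; 38; 69; 73]; [:: 0; 12; 25; 59]; [:: 2; 29; 39; 54];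
        [:: 1; 69; 74; 77]; [:: 1; 13; 49; 79]; [:: 3; 8; 14; 59];
        [:: 0; 1; 29; 56]; [:: 0; 5; 19; 50]]
    ++ inflate [:: [:: 0; 4; 8; 12]])
   (fun x => x %% 5 < 2).

Definition plan40 : plan := Plan 125 40 5
   [:: [:: 34; 37; 68; 71]; [:: 19; 47; 55; 88]; [:: 14; 23; 81; 90];
        [:: 41; 60; 107; 124]; [:: 8; 95; 111; 117]]
   (orbits 5 (multiplier 5 25 6 [:: 1; 2; 3; 4; 0])
    [:: [:: 0; 6; 98; 105]; [:: 0; 18; 30; 111]; [:: 0; 9; 63; 80];
        [:: 0; 10; 66; 100]; [:: 0; 12; 86; 110]; [:: 0; 4; 5; 77];
        [:: 0; 3; 19; 85]; [:: 0; 44; 50; 123]; [:: 0; 32; 55; 122]])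
   (fun x => x %% 5 < 2).

Definition plan45 : plan := Plan 140 45 5
   [:: [:: 1; 64; 103; 122]; [:: 0; 58; 79; 117]; [:: 20; 22; 26; 122];
        [:: 40; 43; 86; 103]; [:: 64; 66; 80; 84]]
   ((orbits 3 (multiplier 5 28 9 [:: 0; 1; 3; 4; 2])
    [:: [:: 1; 3; 31; 112]; [:: 1; 21; 52; 62]; [:: 1; 49; 77; 78];
        [:: 1; 6; 22; 68]; [:: 2; 9; 92; 124]; [:: 2; 18; 24; 47];
        [:: 1; 12; 27; 89]; [:: 0; 31; 77; 83]; [:: 0; 12; 87; 99];
        [:: 0; 9; 22; 82]; [:: 0; 27; 32; 57]; [:: 0; 5; 61; 67];
        [:: 0; 10; 26; 91]; [:: 0; 48; 75; 127]; [:: 0; 13; 97; 100]])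
    ++ inflate [:: [:: 0; 7; 14; 21]])
   (fun x => x %% 5 < 2).

Definition plan60 : plan := Plan 185 60 5
   [:: [:: 1; 28; 69; 97]; [:: 0; 32; 44; 118]; [:: 32; 90; 156; 157];
        [:: 71; 73; 118; 160]; [:: 44; 120; 146; 149]]
   ((orbits 3 (multiplier 5 37 10 [:: 0; 1; 3; 4; 2])
    [:: [:: 0; 34; 43; 117]; [:: 2; 28; 87; 149]; [:: 2; 47; 124; 148];
        [:: 0; 47; 72; 142]; [:: 0; 74; 147; 158]; [:: 0; 42; 122; 149];
        [:: 0; 27; 68; 99]; [:: 0; 2; 48; 144]; [:: 0; 12; 88; 95];
        [:: 0; 76; 87; 162]; [:: 0; 13; 92; 121]; [:: 0; 10; 70; 116];
        [:: 1; 117; 127; 159]; [:: 0; 82; 146; 176]; [:: 1; 27; 67; 106];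
        [:: 1; 42; 86; 162]; [:: 1; 82; 83; 91]])
    ++ inflate [:: [:: 0; 3; 30; 4]])
   (fun x => x %% 5 < 2).

Definition plan65 : plan := Plan 200 65 5
   [:: [:: 5; 13; 192; 195]; [:: 9; 14; 193; 199]; [:: 8; 10; 194; 198];
        [:: 7; 11; 190; 197]; [:: 6; 12; 191; 196]]
   (orbits 5 semidirect_flip
    [:: [:: 0; 50; 100; 150]; [:: 0; 123; 85; 177]; [:: 0; 162; 171; 140];
        [:: 0; 86; 54; 193]; [:: 0; 6; 141; 114]; [:: 0; 11; 185; 112];
        [:: 0; 81; 122; 107]; [:: 0; 128; 62; 199]; [:: 0; 121; 169; 149];
        [:: 0; 2; 49; 154]; [:: 0; 80; 167; 148]; [:: 0; 161; 125; 72];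
        [:: 0; 47; 48; 131]; [:: 0; 40; 172; 142]; [:: 0; 42; 139; 29];
        [:: 0; 126; 56; 79]])
   (fun x => (x %/ 5) %% 5 < 2).

Definition plan80 : plan := Plan 245 80 5
   [:: [:: 1; 84; 198; 217]; [:: 0; 39; 73; 142]; [:: 30; 106; 107; 142];
        [:: 50; 73; 176; 178]; [:: 39; 165; 211; 214]]
   ((orbits 3 (multiplier 5 49 18 [:: 0; 1; 3; 4; 2])
    [:: [:: 0; 38; 117; 165]; [:: 0; 47; 172; 218]; [:: 0; 33; 75; 202];
        [:: 0; 53; 70; 177]; [:: 2; 22; 129; 197]; [:: 2; 33; 143; 172];
        [:: 2; 24; 137; 217]; [:: 0; 2; 115; 226]; [:: 1; 34; 52; 168];
        [:: 1; 112; 113; 229]; [:: 0; 31; 108; 227]; [:: 1; 38; 72; 144];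
        [:: 1; 123; 172; 204]; [:: 0; 52; 71; 176]; [:: 1; 51; 177; 228];
        [:: 0; 37; 81; 201]; [:: 1; 32; 77; 111]])
    ++ inflate [:: [:: 0; 1; 18; 30]; [:: 0; 3; 5; 41]])
   (fun x => x %% 5 < 2).

Definition plan85 : plan := Plan 260 85 5
   [:: [:: 1; 28; 207; 229]; [:: 0; 2; 3; 4]; [:: 1; 55; 79; 108];
        [:: 1; 157; 169; 235]; [:: 1; 35; 98; 187]]
   ((orbits 3 (multiplier 5 52 9 [:: 0; 1; 3; 4; 2])
    [:: [:: 2; 33; 82; 208]; [:: 2; 17; 74; 109]; [:: 2; 37; 89; 113];
        [:: 2; 38; 52; 189]; [:: 1; 107; 168; 189]; [:: 1; 179; 202; 232];
        [:: 1; 173; 234; 252]; [:: 1; 94; 172; 242]; [:: 1; 62; 87; 156];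
        [:: 1; 22; 36; 113]; [:: 1; 52; 112; 136]; [:: 0; 109; 167; 188];
        [:: 0; 166; 236; 247]; [:: 0; 32; 168; 201]; [:: 0; 16; 72; 227];
        [:: 0; 83; 157; 177]; [:: 0; 171; 231; 251]; [:: 0; 62; 96; 232];
        [:: 0; 17; 126; 202]; [:: 0; 21; 57; 191]; [:: 0; 73; 82; 92];
        [:: 0; 77; 88; 172]; [:: 0; 25; 52; 137]; [:: 0; 11; 192; 200];
        [:: 0; 37; 187; 210]; [:: 0; 10; 22; 185]])
    ++ inflate [:: [:: 0; 13; 26; 39]; [:: 0; 1; 9; 29]])
   (fun x => x %% 5 < 2).

Definition plan100 : plan := Plan 305 100 5
   [:: [:: 1; 57; 108; 149]; [:: 0; 43; 52; 219]; [:: 147; 162; 250; 256];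
        [:: 58; 200; 253; 266]; [:: 91; 109; 160; 204]]
   ((orbits 3 (multiplier 5 61 13 [:: 0; 1; 3; 4; 2])
    [:: [:: 2; 7; 144; 217]; [:: 2; 57; 132; 304]; [:: 2; 12; 74; 267];
        [:: 2; 19; 72; 268]; [:: 1; 42; 54; 218]; [:: 1; 112; 172; 179];
        [:: 1; 12; 109; 173]; [:: 1; 72; 204; 267]; [:: 1; 164; 203; 252];
        [:: 1; 53; 196; 302]; [:: 1; 11; 177; 268]; [:: 1; 61; 198; 292];
        [:: 0; 139; 232; 248]; [:: 0; 74; 243; 302]; [:: 0; 132; 297; 298];
        [:: 0; 107; 176; 238]; [:: 0; 76; 166; 172]; [:: 0; 7; 112; 247];
        [:: 0; 42; 211; 216]; [:: 0; 16; 257; 266]; [:: 0; 8; 97; 240];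
        [:: 0; 63; 75; 167]; [:: 0; 55; 198; 252]; [:: 0; 10; 146; 147];
        [:: 0; 3; 195; 267]; [:: 0; 12; 251; 255]])
    ++ inflate [:: [:: 0; 16; 25; 20]; [:: 0; 7; 30; 24]])
   (fun x => x %% 5 < 2).

Definition plan105 : plan := Plan 320 105 10
   (orbits 2 (dicyclic_flip 16)
     (orbits 5 next_layer [:: [:: 131; 194; 27; 188]]))
   (orbits 2 (dicyclic_flip 16) (orbits 5 next_layer
    [:: [:: 0; 80; 160; 240]; [:: 0; 65; 66; 279]; [:: 0; 179; 253; 296];
        [:: 0; 176; 187; 192]; [:: 0; 257; 266; 304]; [:: 0; 49; 168; 302];
        [:: 0; 15; 60; 269]; [:: 0; 51; 232; 310]; [:: 0; 12; 203; 289];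
        [:: 0; 52; 54; 201]; [:: 0; 71; 159; 235]; [:: 0; 38; 70; 294];
        [:: 0; 22; 26; 244]; [:: 0; 47; 77; 102]; [:: 0; 76; 184; 258];
        [:: 0; 24; 44; 174]; [:: 0; 85; 263; 291]; [:: 0; 78; 91; 285];
        [:: 0; 39; 92; 132]; [:: 0; 35; 255; 299]; [:: 0; 87; 270; 283];
        [:: 0; 90; 145; 272]; [:: 0; 17; 157; 185]; [:: 0; 104; 149; 210];
        [:: 0; 43; 56; 243]; [:: 0; 8; 165; 256]]))
   (fun x => x %% 5 < 2).

Definition plan120 : plan := Plan 365 120 5
   [:: [:: 1; 17; 123; 234]; [:: 0; 139; 248; 352]; [:: 16; 112; 257; 350];
        [:: 121; 153; 218; 245]; [:: 109; 135; 231; 264]]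
   ((orbits 3 (multiplier 5 73 8 [:: 0; 1; 3; 4; 2])
    [:: [:: 0; 15; 150; 260]; [:: 0; 16; 121; 231]; [:: 0; 107; 216; 351];
        [:: 1; 138; 247; 354]; [:: 0; 137; 249; 353]; [:: 1; 18; 124; 232];
        [:: 0; 114; 232; 247]; [:: 1; 32; 137; 262]; [:: 0; 122; 242; 259];
        [:: 1; 67; 217; 339]; [:: 0; 67; 95; 221]; [:: 2; 34; 159; 302];
        [:: 1; 68; 214; 337]; [:: 0; 2; 148; 212]; [:: 1; 148; 272; 302];
        [:: 1; 31; 156; 301]; [:: 0; 146; 147; 258]; [:: 0; 151; 302; 303];
        [:: 0; 32; 153; 300]])
    ++ inflate [:: [:: 0; 2; 16; 55]; [:: 0; 11; 15; 47]; [:: 0; 5; 40; 28];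
        [:: 0; 1; 8; 64]])
   (fun x => x %% 5 < 2).

Definition plan125 : plan := Plan 380 125 5
   [:: [:: 1; 82; 124; 183]; [:: 0; 68; 147; 269]; [:: 82; 236; 300; 302];
        [:: 183; 200; 203; 316]; [:: 116; 124; 260; 264]]
   ((orbits 3 (multiplier 5 76 45 [:: 0; 1; 3; 4; 2])
    [:: [:: 0; 20; 180; 260]; [:: 0; 161; 241; 361]; [:: 0; 40; 100; 301];
        [:: 0; 102; 323; 344]; [:: 0; 44; 63; 282]; [:: 1; 103; 324; 342];
        [:: 1; 42; 323; 362]; [:: 0; 22; 62; 202]; [:: 0; 71; 81; 142];
        [:: 0; 12; 122; 281]; [:: 0; 303; 312; 321]; [:: 1; 114; 182; 223];
        [:: 0; 42; 314; 322]; [:: 1; 41; 312; 322]; [:: 0; 138; 157; 379];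
        [:: 2; 22; 203; 268]; [:: 2; 23; 104; 247]; [:: 2; 7; 122; 269];
        [:: 0; 113; 222; 377]; [:: 1; 69; 202; 203]; [:: 1; 83; 161; 317];
        [:: 1; 7; 143; 146]; [:: 0; 103; 242; 246]; [:: 0; 21; 266; 267];
        [:: 0; 237; 243; 302]; [:: 0; 136; 145; 372]; [:: 0; 112; 182; 245];
        [:: 0; 7; 268; 270]])
    ++ inflate [:: [:: 0; 19; 38; 57]; [:: 0; 41; 58; 51]; [:: 0; 21; 26; 15];
        [:: 0; 33; 30; 67]])
   (fun x => x %% 5 < 2).

Definition plan140 : plan := Plan 425 140 5
   [:: [:: 24; 193; 256; 343]; [:: 87; 109; 170; 362];
        [:: 66; 107; 322; 341]; [:: 23; 85; 235; 408];
        [:: 174; 259; 321; 405]]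
   ((orbits 2 (multiplier 5 85 69 [:: 1; 0; 3; 2; 4])
    [:: [:: 2; 87; 208; 307]; [:: 0; 107; 209; 326]; [:: 0; 124; 222; 329];
        [:: 1; 104; 122; 222]; [:: 0; 22; 120; 325]; [:: 0; 102; 221; 309];
        [:: 0; 206; 307; 328]; [:: 0; 154; 236; 259]; [:: 0; 2; 389; 406];
        [:: 0; 87; 174; 409]; [:: 0; 151; 152; 219]; [:: 2; 153; 192; 344];
        [:: 1; 41; 212; 277]; [:: 0; 21; 237; 407]; [:: 1; 152; 218; 236];
        [:: 0; 69; 217; 257]; [:: 0; 23; 40; 212]; [:: 0; 42; 105; 190];
        [:: 2; 4; 43; 214]; [:: 0; 41; 44; 255]; [:: 2; 44; 194; 258];
        [:: 0; 20; 86; 191]; [:: 2; 3; 22; 108]; [:: 0; 1; 67; 238];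
        [:: 2; 124; 224; 343]])
    ++ inflate [:: [:: 0; 5; 15; 40]; [:: 0; 7; 33; 56]; [:: 0; 58; 67; 39];
        [:: 0; 1; 3; 74]; [:: 0; 69; 37; 6]])
   (fun x => x %% 5 < 2).

Definition plan145 : plan := Plan 440 145 10
   (orbits 2 (dicyclic_flip 22)
     (orbits 5 next_layer [:: [:: 231; 214; 207; 428]]))
   (orbits 2 (dicyclic_flip 22) (orbits 5 next_layer
    [:: [:: 0; 110; 220; 330]; [:: 0; 56; 370; 429]; [:: 0; 1; 58; 72];
        [:: 0; 55; 150; 336]; [:: 0; 14; 291; 419]; [:: 0; 13; 160; 294];
        [:: 0; 21; 216; 244]; [:: 0; 129; 203; 406]; [:: 0; 23; 212; 425];
        [:: 0; 116; 153; 368]; [:: 0; 24; 146; 254]; [:: 0; 2; 117; 367];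
        [:: 0; 20; 132; 252]; [:: 0; 74; 202; 310]; [:: 0; 10; 124; 131];
        [:: 0; 11; 122; 240]]
    ++ inflate [:: [:: 0; 45; 33; 28]; [:: 0; 65; 31; 13]; [:: 0; 63; 10; 16];
        [:: 0; 7; 15; 68]]))
   (fun x => x %% 5 < 2).

Definition plan160 : plan := Plan 485 160 5
   [:: [:: 1; 223; 327; 429]; [:: 0; 64; 162; 268]; [:: 160; 222; 267; 326];
        [:: 63; 221; 265; 428]; [:: 60; 164; 329; 426]]
   ((orbits 3 (multiplier 5 97 35 [:: 0; 1; 3; 4; 2])
    [:: [:: 1; 62; 281; 428]; [:: 1; 47; 166; 372]; [:: 2; 4; 48; 207];
        [:: 1; 118; 322; 442]; [:: 1; 2; 103; 146]; [:: 2; 63; 227; 342];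
        [:: 2; 107; 228; 374]; [:: 0; 122; 284; 442]; [:: 0; 123; 167; 267];
        [:: 0; 46; 147; 371]; [:: 0; 118; 221; 342]; [:: 0; 60; 208; 322];
        [:: 0; 61; 207; 320]; [:: 0; 2; 100; 381]; [:: 0; 145; 367; 427]])
    ++ inflate [:: [:: 0; 4; 43; 50]; [:: 0; 1; 35; 61]; [:: 0; 6; 16; 75];
        [:: 0; 15; 40; 42]; [:: 0; 3; 8; 86]; [:: 0; 18; 48; 31]])
   (fun x => x %% 5 < 2).

Definition plan165 : plan := Plan 500 165 10
   (orbits 2 (dicyclic_flip 25)
     (orbits 5 next_layer [:: [:: 281; 224; 297; 48]]))
   (orbits 2 (dicyclic_flip 25) (orbits 5 next_layer
    [:: [:: 0; 5; 250; 255]; [:: 0; 47; 98; 396]; [:: 0; 8; 349; 450];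
        [:: 0; 1; 148; 353]; [:: 0; 9; 201; 346]; [:: 0; 13; 53; 354];
        [:: 0; 19; 214; 309]; [:: 0; 6; 253; 265]; [:: 0; 10; 61; 350];
        [:: 0; 44; 202; 262]; [:: 0; 21; 64; 284]; [:: 0; 14; 32; 292];
        [:: 0; 11; 30; 63]; [:: 0; 12; 41; 300]; [:: 0; 2; 296; 325];
        [:: 0; 20; 326; 483]]
    ++ inflate [:: [:: 0; 35; 46; 22]; [:: 0; 27; 36; 43]; [:: 0; 34; 81; 67];
        [:: 0; 25; 20; 38]; [:: 0; 45; 74; 73]]))
   (fun x => x %% 5 < 2).

Definition plan180 : plan := Plan 545 180 5
   [:: [:: 1; 122; 479; 498]; [:: 0; 52; 73; 429]; [:: 52; 425; 496; 497];
        [:: 50; 73; 476; 478]; [:: 70; 121; 124; 429]]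
   ((orbits 3 (multiplier 5 109 45 [:: 0; 1; 3; 4; 2])
    [:: [:: 0; 50; 305; 407]; [:: 0; 287; 408; 427]; [:: 0; 22; 144; 262];
        [:: 0; 2; 20; 308]; [:: 2; 54; 357; 428]; [:: 2; 33; 172; 292];
        [:: 0; 192; 448; 477]; [:: 1; 123; 377; 407]; [:: 1; 287; 307; 478];
        [:: 0; 31; 101; 292]; [:: 0; 257; 356; 376]; [:: 1; 72; 142; 446];
        [:: 1; 259; 357; 358]; [:: 0; 32; 286; 478]; [:: 0; 121; 377; 406]])
    ++ inflate [:: [:: 0; 1; 45; 63]; [:: 0; 9; 78; 22]; [:: 0; 30; 42; 37];
        [:: 0; 8; 33; 68]; [:: 0; 2; 90; 17]; [:: 0; 3; 26; 80];
        [:: 0; 16; 66; 27]])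
   (fun x => x %% 5 < 2).

Definition plan185 : plan := Plan 560 185 10
   (orbits 2 (dicyclic_flip 28)
     (orbits 5 next_layer [:: [:: 146; 429; 32; 533]]))
   (orbits 2 (dicyclic_flip 28) (orbits 5 next_layer
    [:: [:: 0; 140; 280; 420]; [:: 0; 50; 233; 284]; [:: 0; 18; 82; 412];
        [:: 0; 17; 399; 445]; [:: 0; 19; 67; 80]; [:: 0; 15; 31; 199];
        [:: 0; 65; 195; 482]; [:: 0; 48; 131; 556]; [:: 0; 49; 428; 440];
        [:: 0; 2; 30; 441]; [:: 0; 46; 152; 498]; [:: 0; 62; 442; 559];
        [:: 0; 45; 105; 110]; [:: 0; 16; 458; 472]; [:: 0; 107; 132; 558];
        [:: 0; 66; 90; 545]; [:: 0; 47; 196; 504]; [:: 0; 68; 431; 537];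
        [:: 0; 63; 144; 473]; [:: 0; 1; 114; 143]; [:: 0; 91; 424; 539]]
    ++ inflate [:: [:: 0; 37; 57; 108]; [:: 0; 47; 58; 110]; [:: 0; 7; 44; 71];
        [:: 0; 50; 67; 81]; [:: 0; 70; 38; 78]]))
   (fun x => x %% 5 < 2).

Definition plans : seq plan :=
  [:: plan13; plan17; plan20; plan21; plan24; plan25; plan40; plan45; plan60;
      plan65; plan80; plan85; plan100; plan105; plan120; plan125; plan140;
      plan145; plan160; plan165; plan180; plan185].

Definition dominating_ok (P : plan) : bool :=
  (lines_per_point P == 13) || (5 %| lines_per_point P) ==> dominating P.

Lemma plans_ok : all (fun P => plan_ok P && dominating_ok P) plans.
Proof. by vm_cast_no_check (erefl true). Qed.

Lemma all_mem_map (A : Type) (B : eqType) (f : A -> B) (a : pred A) s y :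
  all a s -> y \in [seq f x | x <- s] -> exists2 x, a x & y = f x.
Proof.
elim: s => //= x s IH /andP[ax /IH{}IH]; rewrite inE => /predU1P[->|//].
by exists x.
Qed.

Theorem lemma6p6 (r : nat)
  (hr : r \in [:: 13; 17; 20; 21; 24; 25; 40; 45; 60; 65; 80; 85; 100; 105;
                  120; 125; 140; 145; 160; 165; 180; 185]) :
  exists (T : finType) (L : {set {set T}}) (S : {set T}),
    [/\ pentagonal_geometry 4 r L,
        connected_graph (deficiency_graph L),
        girth_at_least 5 (deficiency_graph L),
        best_possible_code 4 (deficiency_graph L) S
      & (r = 13 \/ r = 0 %[mod 5] -> code_pi 0 (deficiency_graph L) S = 0)].
Proof.
have r_plan : r \in [seq lines_per_point P | P <- plans] by exact: hr.
have [P /andP[ok dom] ->] := all_mem_map plans_ok r_plan.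
have [T [L [S [pent conn girth best pi0]]]] := plan_sound ok.
exists T, L, S; split=> // r_case; apply: pi0.
apply: (implyP dom); apply/orP.
by case: r_case => /eqP rP; [left | right].
Qed.
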